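(* Let $E$ be an sc-Banach space and let $A\subset E$ be an sc-subspace of finite codimension, i.e. $\dim E/A<\infty$. Then $A$ is sc-complemented in $E$.
   Context: All vector spaces are real. An sc-Banach space (Banach scale) $E$ is a Banach space together with a nested sequence of linear subspaces (levels) $E=E_0\supset E_1\supset E_2\supset\dots$ such that: each level $E_m$ is a Banach space under its own norm $|\cdot|_m$; each inclusion $E_m\hookrightarrow E_{m-1}$, $m\ge 1$, is a compact linear operator; and $E_\infty:=\bigcap_{m\ge 0}E_m$ is dense in every $E_m$. An sc-subspace of $E$ is a closed linear subspace $A$ of $E=E_0$ such that the intersections $A_m:=A\cap E_m$, with the norms of $E_m$, are the levels of an sc-Banach space (i.e. satisfy the three conditions above). An sc-subspace $F\subset E$ is sc-complemented if there is an sc-subspace $G\subset E$ (an sc-complement of $F$) such that for every $m\in\mathbb{N}_0$ one has the Banach space direct sum $F_m\oplus G_m=E_m$ (i.e. $F_m\cap G_m=\{0\}$ and $F_m+G_m=E_m$, with $F_m,G_m$ closed in $E_m$). *)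

(* Defs.v *)
From HB Require Import structures.
From mathcomp Require Import all_boot all_order all_algebra.
From mathcomp Require Import generic_quotient ring_quotient.
From mathcomp Require Import all_classical all_reals.
From mathcomp Require Import topology normedtype.

Set Implicit Arguments.
Unset Strict Implicit.
Unset Printing Implicit Defensive.

Import Order.TTheory GRing.Theory Num.Theory.
Import numFieldNormedType.Exports.
Local Open Scope classical_set_scope.
Local Open Scope quotient_scope.
Local Open Scope ring_scope.

Section NormedSubspace.
Variables (R : realType) (V : lmodType R).

(* [ns_norm] is total on [V], but only its values on the subspace matter: the
   axioms and everything below are restricted to the subspace. *)
Record normedSubspace := NormedSubspace {
  ns_space :> submodClosed V;
  ns_norm : V -> R;
  ns_normD : {in ns_space &, forall x y,
                ns_norm (x + y) <= ns_norm x + ns_norm y};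
  ns_normZ : forall a, {in ns_space, forall x,
                ns_norm (a *: x) = `|a| * ns_norm x};
  ns_norm0_eq0 : {in ns_space, forall x, ns_norm x = 0 -> x = 0}
}.

Record nsType (X : normedSubspace) := NSType {
  ns_val :> V;
  ns_valP : ns_val \in (X : submodClosed V)
}.

Section NormedModule.
Variable X : normedSubspace.

HB.instance Definition _ := [isSub for @ns_val X].
HB.instance Definition _ := [Choice of nsType X by <:].
HB.instance Definition _ := [SubChoice_isSubLmodule of nsType X by <:].

Let norm (x : nsType X) : R := ns_norm X (val x).

Let ler_normD x y : norm (x + y) <= norm x + norm y.
Proof. by rewrite /norm GRing.valD ns_normD// (valP x, valP y). Qed.

Let normrZ a x : norm (a *: x) = `|a| * norm x.
Proof. by rewrite /norm GRing.valZ ns_normZ// (valP x). Qed.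

Let normr0_eq0 x : norm x = 0 -> x = 0.
Proof.
by move=> nx0; apply: val_inj; rewrite (ns_norm0_eq0 (valP x) nx0) GRing.val0.
Qed.

HB.instance Definition _ :=
  Lmodule_isNormed.Build R (nsType X) ler_normD normrZ normr0_eq0.

End NormedModule.

Section Inclusion.
Variables (X Y : normedSubspace) (sXY : {subset X <= Y}).

Definition ns_incl (x : nsType X) : nsType Y := NSType (sXY (valP x)).

Let ns_incl_is_linear : linear ns_incl.
Proof. by move=> a x y; apply: val_inj. Qed.

HB.instance Definition _ := GRing.isLinear.Build R (nsType X) (nsType Y) _
  ns_incl ns_incl_is_linear.

End Inclusion.

Section Intersection.
Variables (A : submodClosed V) (X : normedSubspace).

Definition ns_cap_set : V -> bool := [predI A & X].

Let ns_cap_closed : subsemimod_closed ns_cap_set.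
Proof.
split; first split.
- by rewrite inE/= !rpred0.
- by move=> x y /andP[Ax Xx] /andP[Ay Xy]; apply/andP; split; apply: rpredD.
- by move=> a x /andP[Ax Xx]; apply/andP; split; apply: rpredZ.
Qed.

HB.instance Definition _ :=
  GRing.isSubmodClosed.Build R V ns_cap_set ns_cap_closed.

Let ns_capD : {in ns_cap_set &, forall x y,
  ns_norm X (x + y) <= ns_norm X x + ns_norm X y}.
Proof. by move=> x y /andP[_ Xx] /andP[_ Xy]; apply: ns_normD. Qed.

Let ns_capZ a : {in ns_cap_set, forall x,
  ns_norm X (a *: x) = `|a| * ns_norm X x}.
Proof. by move=> x /andP[_ Xx]; apply: ns_normZ. Qed.

Let ns_cap0 : {in ns_cap_set, forall x, ns_norm X x = 0 -> x = 0}.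
Proof. by move=> x /andP[_ Xx]; apply: ns_norm0_eq0. Qed.

Definition ns_cap : normedSubspace :=
  @NormedSubspace (GRing.SubmodClosed.clone R V ns_cap_set _) (ns_norm X)
    ns_capD ns_capZ ns_cap0.

End Intersection.

End NormedSubspace.

(* The property packed in [completeNormedModType]. *)
Definition is_banach (R : realType) (U : normedModType R) : Prop :=
  forall F : set_system U, ProperFilter F -> cauchy F -> cvg F.

Definition compact_operator (R : realType) (U W : normedModType R)
    (f : {linear U -> W}) : Prop :=
  forall B : set U, bounded_set B -> precompact (f @` B).

Record sc_scale (R : realType) (V : lmodType R)
    (X : nat -> normedSubspace V) : Prop := ScScale {
  sc_nested : forall m, {subset X m.+1 <= X m};
  sc_banach : forall m, is_banach (nsType (X m));
  sc_compact : forall m, compact_operator (ns_incl (@sc_nested m));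
  sc_dense : forall m,
    dense [set x : nsType (X m) | forall k, val x \in X k]
}.

(* [sc_level0] and [sc_norm0] express that level 0 is the Banach space itself;
   for [m > 0] only the restriction of [ns_norm (sc_level m)] to level [m] is
   meaningful. *)
Record scBanach (R : realType) := ScBanach {
  sc_space :> completeNormedModType R;
  sc_level : nat -> normedSubspace sc_space;
  sc_level0 : forall x : sc_space, x \in sc_level 0;
  sc_norm0 : forall x : sc_space, ns_norm (sc_level 0) x = `|x|;
  sc_levelP : sc_scale sc_level
}.

Section ScSubspace.
Variables (R : realType) (E : scBanach R).
Implicit Types A F G : submodClosed E.

Definition sub_level A (m : nat) : normedSubspace E := ns_cap A (sc_level E m).

Definition sc_subspace A : Prop :=
  closed [set x : E | x \in A] /\ sc_scale (sub_level A).

Definition closed_in_level A (m : nat) : Prop :=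
  closed [set x : nsType (sc_level E m) | val x \in sub_level A m].

Definition level_direct_sum F G (m : nat) : Prop :=
  [/\ [set` sub_level F m] `&` [set` sub_level G m] = [set 0],
      [set f + g | f in [set` sub_level F m] & g in [set` sub_level G m]]
        = [set` sc_level E m],
      closed_in_level F m & closed_in_level G m].

Definition sc_complemented F : Prop :=
  exists2 G : submodClosed E, sc_subspace G & forall m, level_direct_sum F G m.

End ScSubspace.

(* [Quotient.quot] is the quotient of a zmodType by an additive subgroup; the
   scalar action induced when the subgroup is a linear subspace is added here.
   [zmod_of_submod] is needed because [submodClosed], being stated over
   semirings, does not include closure under opposite. *)
Section QuotientSpace.
Variables (R : pzRingType) (V : lmodType R) (A : submodClosed V).

Definition zmod_of_submod : V -> bool := fun x => x \in A.

HB.instance Definition _ := GRing.isZmodClosed.Build V zmod_of_submod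
  (GRing.submod_closedB (GRing.submodClosedP A)).

Definition quotSpace :=
  Quotient.quot (GRing.ZmodClosed.clone V zmod_of_submod _).

HB.instance Definition _ := Quotient.on quotSpace.
HB.instance Definition _ := GRing.Zmodule.on quotSpace.

Definition quot_scale (a : R) (q : quotSpace) : quotSpace :=
  \pi_quotSpace (a *: repr q).

Lemma quot_piE x y : (\pi_quotSpace x == \pi_quotSpace y) = (x - y \in A).
Proof.
apply/esym.
exact: (@Quotient.idealrBE V (GRing.ZmodClosed.clone V zmod_of_submod _)).
Qed.

Lemma quot_piD x y :
  \pi_quotSpace (x + y) = \pi_quotSpace x + \pi_quotSpace y.
Proof. exact: Quotient.pi_add. Qed.

Let pi_quot_scale a x : \pi_quotSpace (a *: x) = quot_scale a (\pi_quotSpace x).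
Proof.
apply/eqP; rewrite quot_piE -scalerBr rpredZ//.
by rewrite -quot_piE reprK.
Qed.

Let quot_scaleA a b q : quot_scale a (quot_scale b q) = quot_scale (a * b) q.
Proof. by rewrite -[q]reprK -!pi_quot_scale scalerA reprK. Qed.

Let quot_scale1 : left_id 1 quot_scale.
Proof. by move=> q; rewrite -[q]reprK -pi_quot_scale scale1r. Qed.

Let quot_scaleDr : right_distributive quot_scale +%R.
Proof.
move=> a p q; rewrite -[p]reprK -[q]reprK.
by rewrite -quot_piD -!pi_quot_scale scalerDr quot_piD.
Qed.

Let quot_scaleDl q : {morph quot_scale^~ q : a b / a + b}.
Proof.
by move=> a b; rewrite -[q]reprK -!pi_quot_scale scalerDl quot_piD.
Qed.

HB.instance Definition _ := GRing.Zmodule_isLmodule.Build R quotSpace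
  quot_scaleA quot_scale1 quot_scaleDr quot_scaleDl.

Lemma quot_piZ a x : \pi_quotSpace (a *: x) = a *: \pi_quotSpace x.
Proof. exact: pi_quot_scale. Qed.

End QuotientSpace.

Definition finite_dim (R : pzRingType) (W : lmodType R) : Prop :=
  exists n (e : 'I_n -> W),
    forall w, exists c : 'I_n -> R, w = \sum_(i < n) c i *: e i.

(* Main.v *)
(* Take a maximal family in E_oo that is linearly independent modulo A; it is
   finite because dim E/A is finite, and its span C meets A only in 0. On the
   unit sphere of C the distance to the closed subspace A is bounded below, so
   A + C is closed. By maximality A + C contains E_oo, which is dense, hence
   A + C = E. Since C lies in every level, C is an sc-complement: subtracting an
   element of C from a point of E_m does not leave E_m, and each level of C is
   finite dimensional. *)
Require Import Defs.
From HB Require Import structures.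
From mathcomp Require Import all_boot all_order all_algebra.
From mathcomp Require Import all_classical all_reals.
From mathcomp Require Import topology normedtype.

Set Implicit Arguments.
Unset Strict Implicit.
Unset Printing Implicit Defensive.

Import Order.TTheory GRing.Theory Num.Theory.
Import numFieldNormedType.Exports.
Local Open Scope classical_set_scope.
Local Open Scope quotient_scope.
Local Open Scope ring_scope.

(** * Continuity, compactness and distance estimates in normed spaces *)

Lemma linear_rV_continuous (R : realType) (U : normedModType R) n
    (g : {linear 'rV[R]_n -> U}) : continuous g.
Proof.
apply: bounded_linear_continuous; apply/bounded_funP => r.
exists (\sum_(i < n) r * `|g (delta_mx 0 i)|) => v vr.
rewrite {1}(row_sum_delta v) linear_sum.
apply: le_trans (ler_norm_sum _ _ _) _; apply: ler_sum => i _.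
rewrite linearZ normrZ ler_wpM2r//; apply: le_trans vr.
rewrite [leRHS]/Num.norm /= mx_normrE; apply/bigmax_geP; right => /=.
by exists (0, i).
Qed.

(** Each point of [K] has a ball that misses [A], which gives a bound valid near that point;
    compactness, in its near-covering form, makes the bound uniform on [K]. *)
Lemma compact_closed_dist (R : realType) (U : normedModType R) (K A : set U) :
  compact K -> closed A -> K `&` A = set0 ->
  exists2 d : R, 0 < d & forall x a, K x -> A a -> d <= `|x - a|.
Proof.
move=> cK cA KA0.
have : \forall d \near 0^'+, K `<=` (fun x => forall a, A a -> d <= `|x - a|).
  apply: (proj1 (compact_near_coveringP K) cK R (0^'+)
    (fun d x => forall a, A a -> d <= `|x - a|)) => x Kx.
  have : nbhs x (~` A).
    apply: open_nbhs_nbhs; split; first exact: closed_openC.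
    by move=> Ax; suff : set0 x by []; rewrite -KA0.
  move=> /nbhs_normP[r /= r0 xrA].
  (* Half of [r] pays for moving from [x] to [y], the other half for the distance [d] from [y] to
     [a]. *)
  have r2 : 0 < r / 2 by rewrite divr_gt0.
  exists (ball x (r / 2), [set d | d < r / 2]) => [|[y d] /= [xy dr] a Aa].
    by split; [exact: nbhsx_ballx | exact: nbhs_right_lt].
  rewrite leNgt; apply/negP => yad; apply: (xrA a) => //=.
  rewrite -(subrKA y) (le_lt_trans (ler_normD _ _))// (splitr r) ltrD//.
    by move: xy; rewrite -ball_normE.
  exact: lt_trans dr.
move=> H; near (0 : R)^'+ => d; exists d.
  by near: d; exact: nbhs_right_gt.
by move=> x a Kx Aa; apply: (near H d).
Unshelve. all: by end_near. Qed.

Lemma compact_norm_le (R : realType) n (M : R) :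
  compact [set v : 'rV[R]_n | `|v| <= M].
Proof.
apply: bounded_closed_compact.
  exists M; split; first exact: num_real.
  by move=> r Mr v /= vM; apply: le_trans vM (ltW Mr).
apply: (@preimage_closed _ _ (fun v : 'rV[R]_n => `|v|) [set x | x <= M]).
  by move=> v _; apply: norm_continuous.
exact: closed_le.
Qed.

Lemma compact_norm_eq1 (R : realType) n : compact [set v : 'rV[R]_n | `|v| = 1].
Proof.
apply: (@subclosed_compact _ _ [set v : 'rV[R]_n | `|v| <= 1]).
- apply: (@preimage_closed _ _ (fun v : 'rV[R]_n => `|v|) [set x | x = 1]).
    by move=> v _; apply: norm_continuous.
  exact: closed_eq.
- exact: compact_norm_le.
- by move=> v /= ->.
Qed.

(** * Sum of a closed set and a finite-dimensional range *)

Section ModuloClosedSet.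
Variables (R : realType) (U : normedModType R) (n : nat).
Variables (g : {linear 'rV[R]_n -> U}) (A : set U).
Hypotheses (cA : closed A) (AZ : forall t a, A a -> A (t *: a)).
Hypothesis gA : forall v, A (g v) -> v = 0.

(** The image of the unit sphere is compact and misses [A] by [gA], so it stays at positive distance
    from [A]; homogeneity extends the bound to all [v]. *)
Lemma coercive_modulo :
  exists2 d : R, 0 < d & forall v a, A a -> d * `|v| <= `|g v - a|.
Proof.
have [||d d0 dP] := @compact_closed_dist R U
    (g @` [set v : 'rV[R]_n | `|v| = 1]) A _ cA.
- apply: continuous_compact; last exact: compact_norm_eq1.
  by apply: continuous_subspaceT; apply: linear_rV_continuous.
- rewrite -subset0 => _ [[v /= v1 <-] /gA v0].
  by move/eqP: v1; rewrite v0 normr0 eq_sym oner_eq0.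
exists d => // v a Aa; have [->|v0] := eqVneq v 0.
  by rewrite normr0 mulr0.
have vp : 0 < `|v| by rewrite normr_gt0.
have : d <= `|g (`|v|^-1 *: v) - `|v|^-1 *: a|.
  apply: dP; last exact: AZ.
  exists (`|v|^-1 *: v) => //=.
  by rewrite normrZ ger0_norm ?invr_ge0// mulVf// gt_eqF.
by rewrite linearZ -scalerBr normrZ ger0_norm ?invr_ge0// ler_pdivlMl// mulrC.
Qed.

(** Coercivity confines the coefficients [v] of points near [x] to a fixed ball. If [x] were outside
    the set, the compact set of all [x - g v] with [v] in that ball would be at positive distance
    from [A]. *)
Lemma closed_add_range : closed [set x | exists v, A (x - g v)].
Proof.
move=> /= x clx; apply: contrapT => xN.
have [d d0 dP] := coercive_modulo.
(* Any [y] within 1 of [x] with [y - g v] in [A] satisfies [d * |v| <= |y| <= |x| + 1]. *)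
pose M := (`|x| + 1) / d.
have [||e e0 eP] := @compact_closed_dist R U
    ((fun v => x - g v) @` [set v : 'rV[R]_n | `|v| <= M]) A _ cA.
- apply: continuous_compact; last exact: compact_norm_le.
  apply: continuous_subspaceT => v.
  exact: (cvgB (@cvg_cst _ x _ _ _) (@linear_rV_continuous R U n g v)).
- by rewrite -subset0 => _ [[v _ <-] Av]; apply: xN; exists v.
have me : 0 < Num.min 1 e by rewrite lt_min ltr01.
have [y [[v Ayv]]] := clx _ (nbhsx_ballx x _ me).
rewrite -ball_normE /= lt_min => /andP[xy1 xye].
have vM : `|v| <= M.
  rewrite ler_pdivlMr// mulrC.
  (* With this element of [A], the difference bounded from below is exactly [y]. *)
  have := dP v (- (y - g v)); rewrite opprK addrCA subrr addr0 -scaleN1r.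
  move=> /(_ (AZ _ Ayv)) /le_trans; apply.
  rewrite -(subrK x y) addrC (le_trans (ler_normD _ _))// lerD2l ltW//.
  by rewrite distrC.
have := eP (x - g v) (y - g v) (imageP (fun v => x - g v) vM) Ayv.
by rewrite opprB addrA subrK leNgt xye.
Qed.

End ModuloClosedSet.

(** * Finite-dimensional normed spaces *)

Section FiniteDim.
Variables (R : realType) (U : normedModType R) (n : nat).
Variable g : {linear 'rV[R]_n -> U}.
Hypotheses (g_inj : forall v, g v = 0 -> v = 0).
Hypotheses (g_surj : forall x, exists v, g v = x).

(** Coercivity modulo the closed set [[set 0]] says that [g] is bounded below. *)
Lemma bounded_sub_image (B : set U) : bounded_set B ->
  exists M, B `<=` g @` [set v : 'rV[R]_n | `|v| <= M].
Proof.
have [|||d d0 dP] := @coercive_modulo R U n g [set 0].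
- exact/accessible_closed_set1/hausdorff_accessible/norm_hausdorff.
- by move=> t _ ->; rewrite scaler0.
- by move=> v /g_inj.
move=> /pinfty_ex_gt0[M M0 BM].
exists (M / d) => x /BM xM; have [v gv] := g_surj x; exists v => //=.
rewrite ler_pdivlMr// mulrC; apply: le_trans xM.
by rewrite -gv -[g v]subr0; apply: dP.
Qed.

Lemma finite_dim_compact_operator (W : normedModType R) (f : {linear U -> W}) :
  compact_operator f.
Proof.
move=> B /bounded_sub_image[M BM].
apply: (@precompact_subset _ _ (f @` (g @` [set v : 'rV[R]_n | `|v| <= M]))).
  exact: image_subset.
apply: compact_precompact; first exact: norm_hausdorff.
rewrite image_comp; apply: continuous_compact; last exact: compact_norm_le.
apply: continuous_subspaceT => v.
exact: (@linear_rV_continuous R W n [the {linear _ -> _} of f \o g] v).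
Qed.

(** The identity is a compact operator, so unit balls are precompact; a Cauchy filter contains such
    a ball, hence a compact set, and therefore converges. *)
Lemma finite_dim_is_banach : is_banach U.
Proof.
move=> F FF cF.
have [x Fx] := proj1 (cauchyP F) cF 1 ltr01.
have [|K xK [cK _]] := @finite_dim_compact_operator U
    [the {linear _ -> _} of idfun] (ball x 1).
  exists (`|x| + 1); split=> [|r Mr y]; first exact: num_real.
  rewrite -ball_normE /= => xy; apply: le_trans (ltW Mr).
  by rewrite -(subrK x y) addrC (le_trans (ler_normD _ _))// lerD2l distrC ltW.
apply: (@compact_cauchy_cvg _ K) => //; apply: filterS Fx => y xy.
by apply: xK; exists y.
Qed.
End FiniteDim.

Lemma compact_operator_continuous (R : realType) (U W : normedModType R)
  (f : {linear U -> W}) : compact_operator f -> continuous f.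
Proof.
move=> cf; apply: bounded_linear_continuous; apply/bounded_funP => r.
have [|K fK [cK _]] := cf [set x | `|x| <= r].
  exists r; split=> [|s rs x /= xr]; first exact: num_real.
  exact: le_trans xr (ltW rs).
have /pinfty_ex_gt0[M _ KM] := compact_bounded cK.
by exists M => x xr; apply/KM/fK; exists x.
Qed.

(** * Linear independence modulo a subspace *)

Section Codimension.
Variables (R : fieldType) (V : lmodType R) (A : submodClosed V).

Definition quot_map (x : V) : quotSpace A := \pi_(quotSpace A) x.

Let quot_map_is_linear : linear quot_map.
Proof. by move=> a x y; rewrite /quot_map quot_piD quot_piZ. Qed.

HB.instance Definition _ := GRing.isLinear.Build R V (quotSpace A) _
  quot_map quot_map_is_linear.

Lemma quot_map_eq0 x : (quot_map x == 0) = (x \in A).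
Proof. by rewrite -(linear0 quot_map) quot_piE subr0. Qed.

(** Expanding the classes of the [k] basis images over [e] gives a [k] by [n] matrix. If [n < k],
    some nonzero row vector kills it, and [g] sends that vector into [A]. *)
Lemma independent_modulo_leq n (e : 'I_n -> quotSpace A) k
    (g : {linear 'rV[R]_k -> V}) :
    (forall w, exists c : 'I_n -> R, w = \sum_(i < n) c i *: e i) ->
    (forall v, g v \in A -> v = 0) ->
  (k <= n)%N.
Proof.
move=> e_span g_indep; rewrite leqNgt; apply/negP => nk.
have /choice[c cE] : forall i, exists c : 'I_n -> R,
    quot_map (g (delta_mx 0 i)) = \sum_(j < n) c j *: e j.
  by move=> i; apply: e_span.
pose M := \matrix_(i < k, j < n) c i j.
have /rowV0Pn[v /sub_kermxP vM] : kermx M != 0.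
  by rewrite kermx_eq0 /row_free neq_ltn (leq_ltn_trans (rank_leq_col M) nk).
rewrite (g_indep v) ?eqxx// -quot_map_eq0.
rewrite [v in g v]row_sum_delta !linear_sum.
under eq_bigr do rewrite !linearZ/= cE scaler_sumr.
rewrite exchange_big big1// => j _.
under eq_bigr do rewrite scalerA.
rewrite -scaler_suml.
have /matrixP/(_ 0 j) := vM; rewrite !mxE.
under eq_bigr do rewrite mxE.
by move=> ->; rewrite scale0r.
Qed.

Section Extension.
Variables (k : nat) (g : {linear 'rV[R]_k -> V}) (x : V).

Definition row_extend (v : 'rV[R]_(1 + k)) : V := v 0 0 *: x + g (rsubmx v).

Let row_extend_is_linear : linear row_extend.
Proof.
move=> a u v; rewrite /row_extend linearP !mxE linearP scalerDl scalerDr.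
by rewrite -scalerA addrACA.
Qed.

HB.instance Definition _ := GRing.isLinear.Build R 'rV[R]_(1 + k) V _
  row_extend row_extend_is_linear.

Lemma row_extend_independent :
    (forall v, g v \in A -> v = 0) -> (forall v, x - g v \notin A) ->
  forall v, row_extend v \in A -> v = 0.
Proof.
move=> g_indep xN v; rewrite /row_extend.
have [v0 /=|v0 vA] := eqVneq (v 0 0) 0.
  rewrite v0 scale0r add0r => /g_indep v1.
  rewrite -(hsubmxK v) v1 (_ : lsubmx v = 0) ?row_mx0//.
  apply/matrixP => i j; rewrite !ord1 !mxE -[RHS]v0; congr (v _ _).
  exact: val_inj.
(* Dividing by the nonzero coefficient of [x] would exhibit [x] as an element of the range of [g]
   modulo [A]. *)
have := xN (- (v 0 0)^-1 *: rsubmx v).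
by rewrite linearZ/= scaleNr opprK -{1}[x](scalerK v0) -scalerDr rpredZ.
Qed.

End Extension.

(** Lengths of independent families in [D] are bounded by [independent_modulo_leq]; at the maximal
    length, a point of [D] not reached modulo [A] would extend the family. *)
Lemma maximal_independent_modulo (D : set V) :
    D 0 -> (forall a x y, D x -> D y -> D (a *: x + y)) ->
    finite_dim (quotSpace A) ->
  exists n (g : {linear 'rV[R]_n -> V}),
    [/\ forall v, D (g v), forall v, g v \in A -> v = 0 &
        forall x, D x -> exists v, x - g v \in A].
Proof.
move=> D0 DP [n [e e_span]].
pose P k := `[< exists g : {linear 'rV[R]_k -> V},
  (forall v, D (g v)) /\ (forall v, g v \in A -> v = 0) >].
have exP : exists k, P k.
  exists 0%N; apply/asboolP; exists [the {linear 'rV[R]_0 -> V} of \0].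
  by split=> // v _; apply: thinmx0.
have leP k : P k -> (k <= n)%N.
  by move=> /asboolP[g [_]]; apply: independent_modulo_leq.
case: (ex_maxnP exP leP) => k /asboolP[g [gD g_indep]] k_max.
exists k, g; split=> // x Dx; apply: contrapT => xN.
suff /k_max : P k.+1 by rewrite ltnn.
apply/asboolP; exists [the {linear 'rV[R]_(1 + k) -> V} of row_extend g x].
split=> [v|]; first exact: DP.
by apply: row_extend_independent => // v; apply/negP => xv; apply: xN; exists v.
Qed.

End Codimension.

(** * The range of a linear map as a subspace *)

Section LinearRange.
Variables (R : pzRingType) (U V : lmodType R) (g : {linear U -> V}).

Definition linear_range : V -> bool := fun x => `[< exists v, g v = x >].

Let linear_range_closed : subsemimod_closed linear_range.
Proof.
split; first split.
- by apply/asboolP; exists 0; rewrite linear0.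
- move=> _ _ /asboolP[u <-] /asboolP[v <-].
  by apply/asboolP; exists (u + v); rewrite linearD.
- by move=> a _ /asboolP[v <-]; apply/asboolP; exists (a *: v); rewrite linearZ.
Qed.

HB.instance Definition _ :=
  GRing.isSubmodClosed.Build R V linear_range linear_range_closed.

Definition range_submod := GRing.SubmodClosed.clone R V linear_range _.

Lemma range_submodP x : reflect (exists v, g v = x) (x \in range_submod).
Proof. exact: asboolP. Qed.

End LinearRange.

(** * Topology of the levels of an sc-Banach space *)

Section ScLevels.
Variables (R : realType) (E : scBanach R).
Implicit Types A : submodClosed E.

(** The inclusion into [E] factors through the successive compact, hence continuous, inclusions; on
    level 0 the norm is that of [E]. *)
Lemma level_val_continuous m :
  continuous (fun x : nsType (sc_level E m) => val x : E).
Proof.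
elim: m => [|m IHm] x.
  apply: (@bounded_linear_continuous R (nsType (sc_level E 0)) E
    [the {linear _ -> _} of val]).
  by apply/bounded_funP => r; exists r => y; rewrite -sc_norm0.
have incl_cont :=
  compact_operator_continuous (@sc_compact _ _ _ (sc_levelP E) m).
exact: (@continuous_comp (nsType (sc_level E m.+1)) (nsType (sc_level E m)) E
  _ _ x (incl_cont x) (IHm _)).
Qed.

Lemma closed_level A m :
  closed [set x : E | x \in A] -> closed_in_level A m.
Proof.
move=> cA; rewrite /closed_in_level.
have -> : [set x : nsType (sc_level E m) | val x \in sub_level A m] =
    (fun x : nsType (sc_level E m) => val x : E) @^-1` [set x : E | x \in A].
  by apply/seteqP; split=> x /=; rewrite inE/= (valP x) andbT.
by apply: preimage_closed => // x _; apply: level_val_continuous.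
Qed.

(** Otherwise the complement of [B] would pull back to a nonempty open subset of level 0, which
    contains a smooth point by density. *)
Lemma closed_smooth_setT (B : set E) : closed B ->
  (forall x : E, (forall k, x \in sc_level E k) -> B x) -> B = setT.
Proof.
move=> cB EB; apply/seteqP; split=> // x _; apply: contrapT => Bx.
have [||y [By /= /EB]//] := @sc_dense _ _ _ (sc_levelP E) 0
  ((fun x : nsType (sc_level E 0) => val x : E) @^-1` (~` B)).
  by exists (NSType (sc_level0 x)).
apply: open_comp; last exact: closed_openC.
by move=> y _; apply: level_val_continuous.
Qed.

End ScLevels.

(** * Finite-dimensional subspaces of smooth points *)

Section SmoothRange.
Variables (R : realType) (E : scBanach R) (n : nat).
Variable g : {linear 'rV[R]_n -> E}.
Hypothesis g_smooth : forall v k, g v \in sc_level E k.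
Hypothesis g_inj : forall v, g v = 0 -> v = 0.

Let C := range_submod g.

Let g_level v m : g v \in sub_level C m.
Proof. by rewrite inE/= g_smooth andbT; apply/range_submodP; exists v. Qed.

(** Every level of [C] is all of [C], with its own norm; this parametrization lets the
    finite-dimensional results apply to each of them. *)
Let g_at m (v : 'rV[R]_n) : nsType (sub_level C m) := NSType (g_level v m).

Let g_at_is_linear m : linear (@g_at m).
Proof. by move=> a u v; apply: val_inj; rewrite /= linearP. Qed.

HB.instance Definition _ m := GRing.isLinear.Build R 'rV[R]_n
  (nsType (sub_level C m)) _ (@g_at m) (@g_at_is_linear m).

Let g_at_inj m v : g_at m v = 0 -> v = 0.
Proof. by move=> /(congr1 val)/= /g_inj. Qed.

Let g_at_surj m x : exists v, g_at m v = x.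
Proof.
have := valP x; rewrite inE/= => /andP[/range_submodP[v gv] _].
by exists v; apply: val_inj.
Qed.

Let range_nested m : {subset sub_level C m.+1 <= sub_level C m}.
Proof.
move=> x; rewrite !inE/= => /andP[-> xm].
exact: (sc_nested (sc_levelP E)).
Qed.

Lemma range_sc_subspace : sc_subspace C.
Proof.
split.
  have -> : [set x : E | x \in C] = [set x | exists v, [set 0] (x - g v)].
    apply/seteqP; split=> x /=.
      by move=> /range_submodP[v <-]; exists v; rewrite subrr.
    by move=> [v /subr0_eq ->]; apply/range_submodP; exists v.
  apply: closed_add_range.
  - exact/accessible_closed_set1/hausdorff_accessible/norm_hausdorff.
  - by move=> t _ ->; rewrite scaler0.
  - by move=> v /g_inj.
apply: (@ScScale R E (sub_level C) range_nested) => m.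
- exact: (finite_dim_is_banach (@g_at_inj m) (@g_at_surj m)).
- apply: (finite_dim_compact_operator (@g_at_inj m.+1) (@g_at_surj m.+1)).
(* Density is immediate: every point of [C] is already smooth. *)
- move=> O [x Ox] _; exists x; split=> //= k.
  have [v <-] := g_at_surj x; exact: g_level.
Qed.
End SmoothRange.

Theorem proposition2p3p20 (R : realType) (E : scBanach R)
    (A : submodClosed E) (hA : sc_subspace A)
    (hcodim : finite_dim (quotSpace A)) :
  sc_complemented A.
Proof.
have [cA _] := hA.
have [||n [g [g_smooth g_indep g_max]]] :=
    @maximal_independent_modulo R E A
      [set x | forall k, x \in sc_level E k] _ _ hcodim.
- by move=> k; apply: rpred0.
- by move=> a x y xE yE k; rewrite rpredD ?rpredZ ?xE ?yE.
have g_inj v : g v = 0 -> v = 0 by move=> gv; apply: g_indep; rewrite gv rpred0.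
have g_span x : exists v, x - g v \in A.
  (* This set is [A + C]: it is closed and, by maximality of [g], contains the dense set of smooth
     points. *)
  suff span_setT : [set x | exists v, x - g v \in A] = setT.
    by have : [set: E] x by []; rewrite -span_setT.
  apply: closed_smooth_setT => //.
  by apply: (closed_add_range cA) => // t a; apply: rpredZ.
have [cC scC] := range_sc_subspace g_smooth g_inj.
exists (range_submod g) => // m; split; [| |exact: closed_level..].
- apply/seteqP; split=> x /=.
    rewrite !inE/= => -[/andP[xA _] /andP[/range_submodP[v gv] _]].
    by rewrite -gv (g_indep v) ?linear0// gv.
  by move=> ->; rewrite !rpred0.
- apply/seteqP; split=> x /=.
    move=> [a + [c + <-]]; rewrite !inE/= => /andP[_ am] /andP[_ cm].
    exact: rpredD.
  (* The splitting found in [E] respects level [m] because [g v] is smooth. *)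
  move=> xm; have [v xv] := g_span x; exists (x - g v).
    by rewrite inE/= xv -scaleN1r rpredD// rpredZ// g_smooth.
  exists (g v); last exact: subrK.
  by rewrite inE/= g_smooth andbT; apply/range_submodP; exists v.
Qed.
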